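(* Let $G$ be a finite commutative group with $|G|=q$ and let $A\subset G$ be a standard set. Then \[ \frac1q\le \delta(A)\le \lambda^-(A)\le \lambda(A)\le \lambda^+(A)\le \overline\delta(A)\le 1 \quad\text{and}\quad \lambda^-(A)\le \lambda^\pm(A)\le \lambda^+(A). \] Moreover, each of these inequalities can hold with equality (for suitable $G$ and $A$) and each can also hold with strict inequality (for suitable $G$ and $A$). There is no inequality between $\lambda(A)$ and $\lambda^\pm(A)$: there are standard sets with $\lambda(A)>\lambda^\pm(A)$, standard sets with $\lambda(A)<\lambda^\pm(A)$, and standard sets with $\lambda(A)=\lambda^\pm(A)$.
   Context: $G$ is written additively. A set $A\subset G$ is a standard set if $A=-A$ and $0\in A$. A character of $G$ is a homomorphism $\gamma:G\to\{z\in\mathbb C:|z|=1\}$; $\hat G$ is the group of characters and $\mathbf 1$ the principal (trivial) character. For $f:G\to\mathbb R$, $\hat f(\gamma)=\sum_{x\in G}\gamma(x)f(x)$. For a standard set $A$: $\Delta(A)=\max\{|B|:B\subset G,\ (B-B)\cap A=\{0\}\}$, $\overline\Delta(A)=\max\{|B|:B\subset G,\ B-B\subset A\}$, $\delta(A)=\Delta(A)/q$, $\overline\delta(A)=1/\overline\Delta(A)$. Define classes of functions $f:G\to\mathbb R$ not identically zero: $\mathcal S(A)$: $f=0$ on $G\setminus A$; $\mathcal S^-(A)$: $f\le0$ on $G\setminus A$; $\mathcal S^+(A)$: $f=0$ on $G\setminus A$ and $f\ge0$ on $A$; $\mathcal S^\pm(A)$: $f\le 0$ on $G\setminus A$ and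 $f\ge0$ on $A$. Then $\lambda(A)=\min\{f(0)/\hat f(\mathbf 1): f\in\mathcal S(A),\ \hat f(\gamma)\ge0\ \forall \gamma\in\hat G\}$, and $\lambda^-(A),\lambda^+(A),\lambda^\pm(A)$ are defined in the same way with $\mathcal S^-(A),\mathcal S^+(A),\mathcal S^\pm(A)$ respectively in place of $\mathcal S(A)$. *)

(* Defs.v *)
From mathcomp Require Import all_boot all_order all_algebra.
From mathcomp Require Import boolp classical_sets reals.
From mathcomp Require Export complex.

Set Implicit Arguments.
Unset Strict Implicit.
Unset Printing Implicit Defensive.

Import Order.TTheory GRing.Theory Num.Theory.
Local Open Scope ring_scope.
Local Open Scope complex_scope.

Section Combinatorial.
Variable G : finZmodType.
Implicit Types A B : {set G}.

Definition standard A : Prop := A = [set - x | x in A]%SET /\ 0 \in A.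

Definition diffset B : {set G} := [set x - y | x in B, y in B]%SET.

(* The empty set is not admissible here: its difference set misses 0. *)
Definition Delta A : nat :=
  \max_(B : {set G} | diffset B :&: A == [set 0]%SET) #|B|.

Definition Deltabar A : nat := \max_(B : {set G} | diffset B \subset A) #|B|.

End Combinatorial.

Section Real.
Variable R : realType.

Definition delta (G : finZmodType) (A : {set G}) : R :=
  (Delta A)%:R / #|G|%:R.

Definition deltabar (G : finZmodType) (A : {set G}) : R :=
  1 / (Deltabar A)%:R.

Definition is_character (G : finZmodType) (gamma : G -> R[i]) : Prop :=
  (forall x, `|gamma x| = 1) /\
  (forall x y, gamma (x + y) = gamma x * gamma y).

Definition principal (G : finZmodType) : G -> R[i] := fun _ => 1.

Definition fourier (G : finZmodType) (f : G -> R) (gamma : G -> R[i]) : R[i] :=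
  \sum_(x : G) gamma x * (f x)%:C.

Definition nonzero (G : finZmodType) (f : G -> R) : Prop :=
  exists x, f x != 0.

Definition classS (G : finZmodType) (A : {set G}) (f : G -> R) : Prop :=
  nonzero f /\ (forall x, x \notin A -> f x = 0).

Definition classSm (G : finZmodType) (A : {set G}) (f : G -> R) : Prop :=
  nonzero f /\ (forall x, x \notin A -> f x <= 0).

Definition classSp (G : finZmodType) (A : {set G}) (f : G -> R) : Prop :=
  [/\ nonzero f, forall x, x \notin A -> f x = 0
    & forall x, x \in A -> 0 <= f x].

Definition classSpm (G : finZmodType) (A : {set G}) (f : G -> R) : Prop :=
  [/\ nonzero f, forall x, x \notin A -> f x <= 0
    & forall x, x \in A -> 0 <= f x].

(* The order of R[i] is such that 0 <= z means that z is real and nonnegative.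
   A function with nonnegative transform that is not identically zero has
   f 0 > 0, so f 0 / fourier f principal is +oo when the denominator vanishes;
   such functions cannot realize the minimum and are left out, because Rocq's
   total division would give them the value 0. *)
Definition ratios (G : finZmodType) (S : (G -> R) -> Prop) : set R :=
  fun m => exists f : G -> R,
    [/\ S f,
        forall gamma, is_character gamma -> 0 <= fourier f gamma,
        fourier f (@principal G) != 0
      & m%:C = (f 0)%:C / fourier f (@principal G)].

(* The least element of E, or the junk value 0 if E has none. All the minima
   below are claimed to be at least 1 / #|G| > 0, a claim that the junk value
   does not satisfy. *)
Definition minimum (E : set R) : R :=
  xget 0 (fun m => E m /\ forall x, E x -> m <= x).

Definition lambda (G : finZmodType) (A : {set G}) : R :=
  minimum (ratios (classS A)).
Definition lambdam (G : finZmodType) (A : {set G}) : R :=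
  minimum (ratios (classSm A)).
Definition lambdap (G : finZmodType) (A : {set G}) : R :=
  minimum (ratios (classSp A)).
Definition lambdapm (G : finZmodType) (A : {set G}) : R :=
  minimum (ratios (classSpm A)).

Definition for_some_standard (P : forall G : finZmodType, {set G} -> Prop) :
    Prop :=
  exists (G : finZmodType) (A : {set G}), standard A /\ P G A.

Definition sometimes_eq_sometimes_lt
    (u v : forall G : finZmodType, {set G} -> R) : Prop :=
  for_some_standard (fun G A => u G A = v G A) /\
  for_some_standard (fun G A => u G A < v G A).

End Real.

Arguments delta R {G} A.
Arguments deltabar R {G} A.
Arguments lambda R {G} A.
Arguments lambdam R {G} A.
Arguments lambdap R {G} A.
Arguments lambdapm R {G} A.

(* Main.v *)
(* Call f : G -> R positive when its transform is nonnegative. The translations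
   of G are simultaneously diagonalizable, which gives #|G| characters chi with
   sum_chi chi(x) = #|G| [x = 0], hence Parseval's identity. It follows that
   |f x| <= f 0 for positive f, so that normalizing fhat(1) = 1 makes the four
   extremal problems continuous minimizations over compact sets, and that
   fhat(1) (sum g)^2 <= #|G| sum_d f(d) h(d) for the autocorrelation h of any
   real g, which gives delta <= lambda^- with g the indicator of B. The
   autocorrelation of the indicator of B is itself a competitor for lambda^+,
   which gives lambda^+ <= deltabar. The other inequalities are inclusions
   between the classes.

   All the quantities equal 1 on the trivial group. Strictness next to delta and
   deltabar comes from the pentagon in Z/5. In (Z/2)^5, write w for the Hamming
   weight and K_j for the sum of the characters of weight j, let
   f = 2 + K_1 + K_5 and h = 2 + K_3, and note that f(0) / fhat(1) = 1/8.
   If F is positive and F h <= 0 off 0, then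
   2 Fhat(1) <= sum F h <= 12 F(0), so the ratio of F is at least 1/6. On
   A = {f > 0} = {w <= 2} the function f is a competitor for lambda^+- and every
   F in S(A) has F h <= 0 off 0; on A = {f <> 0} = {w <= 2 or w = 5} the
   roles of lambda and lambda^+- are exchanged. The remaining strict
   inequalities follow from these two. *)
Require Import Defs.
From mathcomp Require Import all_boot all_order all_algebra.
From mathcomp Require Import boolp classical_sets.
From mathcomp Require Import reals.
From mathcomp Require Import topology normedtype derive.
From mathcomp Require Import zify ring lra.

Set Implicit Arguments.
Unset Strict Implicit.
Unset Printing Implicit Defensive.

Import Order.TTheory GRing.Theory Num.Theory.
Local Open Scope ring_scope.

(** * Characters and the Fourier transform *)

Lemma card_zmod_neq0 (K : numDomainType) (G : finZmodType) : #|G|%:R != 0 :> K.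
Proof. by rewrite pnatr_eq0 -lt0n; apply/card_gt0P; exists 0. Qed.

(** * Existence of a complete system of characters *)

Section Eigenbasis.
Variables (C : numClosedFieldType) (G : finZmodType).
Import sesquilinear spectral.
Local Open Scope sesquilinear_scope.

(* The translations of G form a commuting family of normal matrices, hence are
   simultaneously diagonal in some orthonormal basis. *)
Lemma translation_eigenbasis :
  exists (P : 'M[C]_#|G|) (chi : 'I_#|G| -> G -> C), P \is unitarymx /\
    forall i x t, P i (enum_rank (x + t)) = chi i t * P i (enum_rank x).
Proof.
pose T (t : G) : 'M[C]_#|G| :=
  \matrix_(y, x) (enum_val y == enum_val x + t)%:R.
have mulT (M : 'M[C]_#|G|) t i x :
    (M *m T t) i x = M i (enum_rank (enum_val x + t)).
  rewrite mxE (bigD1 (enum_rank (enum_val x + t))) //= mxE enum_rankK eqxx.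
  rewrite mulr1 big1 ?addr0 // => j; rewrite mxE => /negPf jx.
  by rewrite (can2_eq enum_valK enum_rankK) jx mulr0.
have TN t : (T t)^t* = T (- t).
  by apply/matrixP => i j; rewrite !mxE conjC_nat [in RHS]eq_sym subr_eq.
have [A B|P Punit /allP PT] := @cotrigonalization _ _ [seq T t | t <- enum G].
  move=> /mapP[t _ ->] /mapP[u _ ->]; apply/matrixP => y x.
  by rewrite !mulT !mxE !enum_rankK -!addrA [t + u]addrC.
pose D t := P *m T t *m P^t*.
have Dtrig t (i j : 'I_#|G|) : (i < j)%N -> D t i j = 0.
  move=> ij; have /PT : T t \in [seq T t | t <- enum G].
    by rewrite map_f // mem_enum.
  by rewrite inE /similar_to conjymx // => /is_trig_mxP ->.
(* The adjoint of [D t] is [D (- t)], again lower triangular; hence [D t] is diagonal. *)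
have DN t i j : D t i j = (D (- t) j i)^*.
  suff -> : D t = (D (- t))^t* by rewrite !mxE.
  by rewrite /D !trmx_mul !map_mxM /= trmxCK TN opprK mulmxA.
have Dneq t i j : i != j -> D t i j = 0.
  by rewrite neq_ltn => /orP[/Dtrig //|/Dtrig ji]; rewrite DN ji conjC0.
exists P, (fun i t => D t i i); split=> // i x t.
have PtP : P^t* *m P = 1%:M by apply: mulmx1C; exact/unitarymxP.
rewrite -{1}[x]enum_rankK -mulT -[P *m T t]mulmx1 -PtP mulmxA mxE (bigD1 i) //=.
by rewrite big1 ?addr0 // => j ij; rewrite [X in X * _]Dneq ?mul0r // eq_sym.
Qed.

(** Row [i] of the unitary matrix is [chi i] times its entry [e i] at 0, which is nonzero since the
    row has norm 1. Cancelling [e i] gives multiplicativity. Translation permutes the entries of a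
    row, so its norm forces [chi i] to have modulus 1 and [e i] to have squared modulus 1 / q.
    Orthogonality of the columns then gives the sum over [i]. *)
Lemma complete_homomorphisms : exists chi : 'I_#|G| -> G -> C,
  [/\ forall i x, `|chi i x| = 1,
      forall i x y, chi i (x + y) = chi i x * chi i y
    & forall x, \sum_i chi i x = (#|G| * (x == 0))%:R].
Proof.
have [P [chi [Punit Pshift]]] := translation_eigenbasis.
pose e i := P i (enum_rank (0 : G)).
have Pchi i t : P i (enum_rank t) = chi i t * e i by rewrite -Pshift add0r.
have rowP1 i : \sum_t `|P i (enum_rank t)| ^+ 2 = 1.
  have <- : (P *m P^t*) i i = 1 by rewrite (unitarymxP Punit) mxE eqxx.
  rewrite mxE [RHS](reindex enum_rank) /=; last exact/onW_bij/enum_rank_bij.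
  by apply: eq_bigr => t _; rewrite !mxE normCK.
have e_neq0 i : e i != 0.
  apply/eqP => e0; have /eqP := rowP1 i; rewrite big1 => [|t _].
    by rewrite eq_sym oner_eq0.
  by rewrite Pchi e0 mulr0 normr0 expr0n.
have chiD i t u : chi i (t + u) = chi i t * chi i u.
  by apply: (mulIf (e_neq0 i)); rewrite -Pchi Pshift Pchi mulrCA mulrA.
have chi_norm i t : `|chi i t| = 1.
  apply/eqP; rewrite -(@pexpr_eq1 _ _ 2) //; apply/eqP.
  rewrite -[LHS]mulr1 -{1}(rowP1 i) big_distrr /= -[RHS](rowP1 i).
  rewrite [RHS](reindex_inj (addrI t)) /=; apply: eq_bigr => u _.
  by rewrite -exprMn -normrM !Pchi chiD mulrA.
have norm_e i : `|e i| ^+ 2 = #|G|%:R^-1.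
  apply: (mulfI (card_zmod_neq0 C G)); rewrite divff ?card_zmod_neq0 //.
  rewrite -[RHS](rowP1 i) mulr_natl -sumr_const; apply: eq_bigr => t _.
  by rewrite Pchi normrM chi_norm mul1r.
exists chi; split=> // x.
have PtP : P^t* *m P = 1%:M by apply: mulmx1C; exact/unitarymxP.
have /matrixP/(_ (enum_rank 0) (enum_rank x)) := PtP.
rewrite !mxE (inj_eq enum_rank_inj) eq_sym natrM => <-; rewrite big_distrr /=.
apply: eq_bigr => i _; rewrite !mxE -/(e i) Pchi [_^* * _]mulrC -mulrA -normCK.
by rewrite norm_e mulrCA divff ?mulr1 ?card_zmod_neq0.
Qed.

End Eigenbasis.

Local Notation "x %:C" := (real_complex _ x) : ring_scope.

(** * Parseval's identity and functions with nonnegative transform *)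

Section Fourier.
Variables (R : realType) (G : finZmodType).
Implicit Types (gamma : G -> R[i]) (f g h : G -> R).

Lemma principal_character : is_character (@principal R G).
Proof. by split=> [x|x y]; rewrite /principal ?normr1 ?mulr1. Qed.

Lemma character_mul gamma1 gamma2 : is_character gamma1 ->
  is_character gamma2 -> is_character (fun x => gamma1 x * gamma2 x).
Proof.
move=> [n1 m1] [n2 m2]; split=> [x|x y]; first by rewrite normrM n1 n2 mulr1.
by rewrite m1 m2 mulrACA.
Qed.

Lemma character_neq0 gamma x : is_character gamma -> gamma x != 0.
Proof. by move=> [gamma1 _]; rewrite -normr_eq0 gamma1 oner_neq0. Qed.

Lemma character0 gamma : is_character gamma -> gamma 0 = 1.
Proof.
move=> chg; apply: (mulfI (character_neq0 0 chg)).
by rewrite mulr1 -(proj2 chg) addr0.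
Qed.

Lemma characterN gamma x : is_character gamma -> gamma (- x) = (gamma x)^*.
Proof.
move=> chg; apply: (mulfI (character_neq0 x chg)).
by rewrite -(proj2 chg) subrr character0 // -normCK (proj1 chg) expr1n.
Qed.

Lemma sum_character gamma : is_character gamma ->
  (gamma = @principal R G /\ \sum_x gamma x = #|G|%:R) \/ \sum_x gamma x = 0.
Proof.
move=> chg; have [|/forallPn[y gy]] := boolP [forall y, gamma y == 1].
  move=> /forallP g1; left; have -> : gamma = @principal R G.
    by apply/funext => y; exact/eqP.
  by split=> //; rewrite /principal sumr_const.
right; have /eqP : \sum_x gamma x = gamma y * \sum_x gamma x.
  rewrite [LHS](reindex_inj (addrI y)) big_distrr /=.
  by apply: eq_bigr => x _; rewrite (proj2 chg).
rewrite -subr_eq0 -{1}[\sum_x _]mul1r -mulrBl mulf_eq0 subr_eq0 eq_sym.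
by rewrite (negPf gy) => /eqP.
Qed.

Lemma sum_character_ge0 gamma : is_character gamma -> 0 <= \sum_x gamma x.
Proof. by move/sum_character => [[_ ->]|->]; rewrite ?ler0n. Qed.

(** The principal character must occur: summing [chi i x] over all [i] and [x] gives q, but the sum
    over [x] of any other character vanishes. *)
Lemma complete_characters : exists chi : 'I_#|G| -> G -> R[i],
  [/\ forall i, is_character (chi i),
      exists i, chi i = @principal R G
    & forall x, \sum_i chi i x = (#|G| * (x == 0))%:R].
Proof.
have [chi [chi1 chiD chi_sum]] := complete_homomorphisms R[i] G.
exists chi; split=> //.
have [//|/forallNP noprincipal] := pselect (exists i, chi i = @principal R G).
have /eqP := card_zmod_neq0 R[i] G; case.
transitivity (\sum_x \sum_i chi i x).
  rewrite (bigD1 0) //= chi_sum eqxx muln1 big1 ?addr0 // => x /negPf x0.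
  by rewrite chi_sum x0 muln0.
rewrite exchange_big big1 // => i _.
by have [//|[/noprincipal]|] := @sum_character (chi i).
Qed.

Definition pos_transform f :=
  forall gamma, is_character gamma -> 0 <= fourier f gamma.

Lemma fourier_principal f : fourier f (@principal R G) = (\sum_x f x)%:C.
Proof. by rewrite rmorph_sum; apply: eq_bigr => x _; rewrite mul1r. Qed.

Lemma pos_transform_sum_ge0 f : pos_transform f -> 0 <= \sum_x f x.
Proof.
by move=> /(_ _ principal_character); rewrite fourier_principal ler0c.
Qed.

Lemma conj_fourier f gamma : is_character gamma ->
  (fourier f gamma)^* = \sum_x gamma (- x) * (f x)%:C.
Proof.
move=> chg; rewrite rmorph_sum; apply: eq_bigr => x _.
by rewrite rmorphM /= -characterN // conj_Creal // complex_real.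
Qed.

Lemma parseval (chi : 'I_#|G| -> G -> R[i]) f h :
    (forall i, is_character (chi i)) ->
    (forall x, \sum_i chi i x = (#|G| * (x == 0))%:R) ->
  \sum_i fourier f (chi i) * (fourier h (chi i))^* =
  #|G|%:R * (\sum_x f x * h x)%:C.
Proof.
move=> chi_char chi_sum.
under eq_bigr => i _ do rewrite conj_fourier // big_distrl /=.
rewrite exchange_big rmorph_sum big_distrr /=; apply: eq_bigr => x _.
under eq_bigr => i _ do rewrite big_distrr /=.
rewrite exchange_big (bigD1 x) //= [X in _ + X]big1 ?addr0 => [|y yx].
  under eq_bigr => i _ do rewrite mulrACA -(proj2 (chi_char i)) subrr.
  by rewrite -big_distrl /= chi_sum eqxx muln1 rmorphM.
under eq_bigr => i _ do rewrite mulrACA -(proj2 (chi_char i)).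
by rewrite -big_distrl /= chi_sum subr_eq0 eq_sym (negPf yx) muln0 mul0r.
Qed.

Definition autocorr g (d : G) : R := \sum_y g (y + d) * g y.

Lemma fourier_autocorr g gamma : is_character gamma ->
  fourier (autocorr g) gamma = `|fourier g gamma| ^+ 2.
Proof.
move=> chg; rewrite normCK conj_fourier // big_distrr /=.
transitivity (\sum_d \sum_y gamma d * (g (y + d) * g y)%:C).
  by apply: eq_bigr => d _; rewrite rmorph_sum big_distrr.
rewrite exchange_big; apply: eq_bigr => y _ /=.
rewrite big_distrl [RHS](reindex_inj (addIr y)) /=; apply: eq_bigr => d _.
rewrite mulrACA -(proj2 chg) addrK rmorphM /=.
by rewrite [d + y]addrC.
Qed.

Lemma autocorr_pos_transform g : pos_transform (autocorr g).
Proof. by move=> gamma chg; rewrite fourier_autocorr // exprn_ge0. Qed.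

Lemma sum_autocorr g : \sum_d autocorr g d = (\sum_x g x) ^+ 2.
Proof.
rewrite exchange_big expr2 big_distrr /=; apply: eq_bigr => y _.
by rewrite -big_distrl /= [in RHS](reindex_inj (addrI y)).
Qed.

(** In Parseval's identity for [f] and [autocorr g] all terms are nonnegative, and the left side is
    the term of the principal character. *)
Lemma autocorr_ineq f g : pos_transform f ->
  (\sum_x f x) * (\sum_x g x) ^+ 2 <= #|G|%:R * \sum_d f d * autocorr g d.
Proof.
move=> f_pos; have [chi [chi_char [i0 chi_i0] chi_sum]] := complete_characters.
have := parseval f (autocorr g) chi_char chi_sum.
rewrite (bigD1 i0) //= chi_i0 !fourier_principal sum_autocorr.
rewrite conj_Creal ?complex_real // -(rmorph_nat (real_complex R)) -!rmorphM /=.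
move=> eq_sum; rewrite -lecR -eq_sum lerDl sumr_ge0 // => i _.
rewrite mulr_ge0 ?f_pos ?conjC_ge0 //; exact: autocorr_pos_transform.
Qed.

(** By Fourier inversion and the triangle inequality: all coefficients are nonnegative and all
    characters equal 1 at 0, so no cancellation occurs there. *)
Lemma pos_transform_norm_le f x : pos_transform f -> `|f x| <= f 0.
Proof.
move=> f_pos; have [chi [chi_char _ chi_sum]] := complete_characters.
pose dirac (y z : G) : R := (z == y)%:R.
(* Inversion is Parseval's identity against the point mass at [y]. *)
have inversion y : #|G|%:R * (f y)%:C = \sum_i fourier f (chi i) * chi i (- y).
  have -> : f y = \sum_z f z * dirac y z.
    rewrite (bigD1 y) //= big1 /dirac ?eqxx ?mulr1 ?addr0 // => z /negPf ->.
    by rewrite mulr0.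
  rewrite -(parseval f (dirac y) chi_char chi_sum); apply: eq_bigr => i _.
  rewrite conj_fourier // (bigD1 y) //= big1 /dirac ?eqxx ?mulr1 ?addr0 //.
  by move=> z /negPf ->; rewrite mulr0.
have q_gt0 : 0 < #|G|%:R :> R[i] by rewrite lt0r card_zmod_neq0 ler0n.
have norm_real (r : R) : `|r%:C| = `|r|%:C :> R[i].
  by rewrite normc_def /= expr0n addr0 sqrtr_sqr.
rewrite -lecR -(ler_pM2l q_gt0) -norm_real inversion.
rewrite -[#|G|%:R]normr_nat -normrM inversion.
apply: le_trans (ler_norm_sum _ _ _) _; rewrite ler_sum // => i _.
rewrite normrM (proj1 (chi_char i)) mulr1 oppr0 character0 // mulr1.
by rewrite ger0_norm // f_pos.
Qed.

End Fourier.

(** * Attainment of the minima *)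

Section Minima.
Variables (R : realType) (G : finZmodType).
Implicit Types (f g : G -> R) (A : {set G}) (S : (G -> R) -> Prop).

(** Moves the quotients from [R[i]] to [R]; the principal coefficient is nonnegative, so being
    nonzero means being positive. *)
Lemma ratiosP S (m : R) : ratios S m <->
  exists f, [/\ S f, pos_transform f, 0 < \sum_x f x & m = f 0 / \sum_x f x].
Proof.
have inj0 (r : R) : (r%:C == 0) = (r == 0) by rewrite eq_complex /= eqxx andbT.
split=> -[f [Sf f_pos]]; rewrite ?fourier_principal.
  rewrite inj0 => sum_neq0 mE; exists f; split=> //.
    by rewrite lt0r sum_neq0 pos_transform_sum_ge0.
  by apply: complexI; rewrite fmorph_div.
move=> sum_gt0 ->; exists f; rewrite fourier_principal; split=> //.
  by rewrite inj0 gt_eqF.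
by rewrite fmorph_div.
Qed.

(** Common shape of the four classes: [K x] will be the line, a closed half-line or the origin. *)
Definition cone_class (K : G -> set R) f := nonzero f /\ forall x, K x (f x).

Lemma pos_transformZ f (a : R) : 0 <= a -> pos_transform f ->
  pos_transform (fun x => a * f x).
Proof.
move=> a0 f_pos gamma chg; rewrite (_ : fourier _ _ = a%:C * fourier f gamma).
  by rewrite mulr_ge0 ?f_pos // ler0c.
by rewrite big_distrr; apply: eq_bigr => x _; rewrite rmorphM mulrCA.
Qed.

Lemma pos_transform_dirac : pos_transform (fun x : G => (x == 0)%:R : R).
Proof.
move=> gamma chg; rewrite /fourier (bigD1 0) //= eqxx mulr1 character0 //.
by rewrite big1 ?addr0 // => x /negPf ->; rewrite mulr0.
Qed.

(** Splits the complex condition into a linear equation and a linear inequality over the reals, both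
    closed in [f]. *)
Lemma fourier_ge0E f (gamma : G -> R[i]) : (0 <= fourier f gamma) =
  (\sum_x complex.Im (gamma x) * f x == 0) &&
  (0 <= \sum_x complex.Re (gamma x) * f x).
Proof.
have -> : fourier f gamma =
    Complex (\sum_x complex.Re (gamma x) * f x)
            (\sum_x complex.Im (gamma x) * f x).
  rewrite /fourier; elim/big_ind3: _ => [//|? a b ? c d -> -> //|x _].
  case: (gamma x) => a b; apply/eqP; rewrite eq_complex /=.
  by rewrite !mulr0 subr0 add0r !eqxx.
by rewrite lecE /=.
Qed.

Import numFieldNormedType.Exports.
Local Open Scope classical_set_scope.

(** Scaling invariance of the cones permits normalizing the sum to 1, and the conditions at 0 and 1
    make the point mass at 0 a competitor, of ratio 1. *)
Lemma minimum_ratios (K : G -> set R) (E := ratios (cone_class K)) :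
    (forall x, closed (K x)) ->
    (forall x (a r : R), 0 <= a -> K x r -> K x (a * r)) ->
    (forall x, K x 0) -> K 0 1 ->
  E (minimum E) /\ forall m, E m -> minimum E <= m.
Proof.
move=> Kclosed Kscale K0 K1.
pose fn (v : 'rV[R]_#|G|) x := v ord0 (enum_rank x).
pose vec f : 'rV[R]_#|G| := \row_i f (enum_val i).
have vecK f x : fn (vec f) x = f x by rewrite /fn mxE enum_rankK.
pose L c v := \sum_x c x * fn v x.
have fn_cont x : continuous (fn^~ x) by exact: coord_continuous.
have L_cont c : continuous (L c).
  apply: continuous_big => [|x _ v]; first exact: add_continuous.
  exact: (continuous_comp (fn_cont x v) (@mulrl_continuous _ (c x) _)).
have closed_pre (h : 'rV[R]_#|G| -> R) D :
    continuous h -> closed D -> closed (h @^-1` D).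
  by move=> /continuous_closedP; apply.
(* The bound 1 on the value at 0 discards only competitors worse than the point mass; it bounds all
   coordinates, hence yields compactness. *)
pose F := [set v | forall x, K x (fn v x)] `&` [set v | L (fun=> 1) v = 1] `&`
  [set v | fn v 0 <= 1] `&` [set v | pos_transform (fn v)].
have F_closed : closed F.
  apply: closedI; first apply: closedI; first apply: closedI.
  - rewrite (_ : mkset _ = \bigcap_x (fn^~ x) @^-1` K x).
      by apply: closed_bigI => x _; exact: closed_pre.
    by apply/seteqP; split=> v /= Kv x; [move=> _; exact: Kv|exact: (Kv x I)].
  - exact: (closed_pre _ [set r | r = 1] (L_cont _) (@closed_eq _ _)).
  - exact: (closed_pre _ [set r | r <= 1] (fn_cont _) (@closed_le _ _)).
  - rewrite (_ : mkset _ = \bigcap_(gamma in @is_character R G)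
        (L (fun x => complex.Im (gamma x)) @^-1` [set r | r = 0] `&`
         L (fun x => complex.Re (gamma x)) @^-1` [set r | 0 <= r])).
      apply: closed_bigI => gamma _; apply: closedI.
        exact: (closed_pre _ _ (L_cont _) (@closed_eq _ _)).
      exact: (closed_pre _ _ (L_cont _) (@closed_ge _ _)).
    apply/seteqP; split=> v /= v_pos gamma chg.
      by have := v_pos _ chg; rewrite fourier_ge0E => /andP[/eqP].
    by have [/eqP e0 ge0] := v_pos gamma chg; rewrite fourier_ge0E; apply/andP.
have F_compact : compact F.
  have box : compact
      [set v : 'rV[R]_#|G| | forall i, `[(-1 : R), 1] (v ord0 i)].
    by apply: (@rV_compact _ _ (fun=> `[(-1 : R), 1])) => _;
       exact: segment_compact.
  apply: subclosed_compact F_closed box _ => v [[_ v0] v_pos] j.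
  rewrite /= in_itv /= -ler_norml -[j]enum_valK.
  exact: le_trans (pos_transform_norm_le _ v_pos) v0.
have F_dirac : F (vec (fun x => (x == 0)%:R)).
  have vecE : fn (vec (fun x => (x == 0)%:R)) = fun x => (x == 0)%:R.
    by apply/funext => x; exact: vecK.
  rewrite /F /L /= vecE; split=> //; last exact: pos_transform_dirac.
  split=> /=; last by rewrite eqxx.
  split=> /= [x|]; first by have [->|] := eqVneq x 0.
  rewrite (bigD1 0) //= eqxx mulr1 big1 ?addr0 // => x /negPf ->.
  by rewrite mulr0.
have [v /set_mem [[[Kv v1] v0] v_pos] v_min] :=
  EVT_min_rV (ex_intro _ _ F_dirac) F_compact
    (continuous_subspaceT (fn_cont (0 : G))).
have {}v1 : \sum_x fn v x = 1.
  by rewrite -[RHS]v1; apply: eq_bigr => x _; rewrite mul1r.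
have Ev : E (fn v 0).
  apply/ratiosP; exists (fn v); rewrite v1 divr1 ltr01; split=> //; split=> //.
  apply: contrapT => /forallNP fn0; have /eqP := oner_neq0 R; case.
  by rewrite -v1 big1 // => x _; apply/eqP/negbNE/negP/fn0.
have v_le m : E m -> fn v 0 <= m.
  move=> /ratiosP[f [[_ Kf] f_pos sum_gt0 ->]].
  have [le1|gt1] := leP (f 0 / \sum_x f x) 1; last exact: le_trans v0 (ltW gt1).
  pose g x := (\sum_x f x)^-1 * f x.
  have sumV_ge0 : 0 <= (\sum_x f x)^-1 by rewrite invr_ge0 ltW.
  have gE : fn (vec g) = g by apply/funext => x; exact: vecK.
  have := v_min (vec g); rewrite gE /g mulrC; apply; apply/mem_set.
  rewrite /F /L /= gE; split; last exact: pos_transformZ.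
  split=> /=; last by rewrite /g mulrC.
  split=> /= [x|]; first exact: Kscale.
  under eq_bigr do rewrite mul1r.
  by rewrite /g -big_distrr /= mulVf // gt_eqF.
(* A least element exists, so [xget] does not return its default 0. *)
rewrite /minimum; case: xgetP => [m -> //|/(_ (fn v 0))]; case.
by split.
Qed.

End Minima.

(** * Comparison principles for attained minima, and the four classes *)

Section Attained.
Variables (R : realType) (G : finZmodType).
Implicit Types (f g : G -> R) (A B : {set G}) (S : (G -> R) -> Prop).

Definition attained S := ratios S (minimum (ratios S)) /\
  forall m, ratios S m -> minimum (ratios S) <= m.

Lemma attained_le S f : attained S -> S f -> pos_transform f ->
  0 < \sum_x f x -> minimum (ratios S) <= f 0 / \sum_x f x.
Proof. by move=> [_ minS] Sf f_pos sum_gt0; apply/minS/ratiosP; exists f. Qed.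

Lemma attained_ge S (c : R) : attained S ->
    (forall f, S f -> pos_transform f -> 0 < \sum_x f x ->
       c * \sum_x f x <= f 0) ->
  c <= minimum (ratios S).
Proof.
move=> [/ratiosP[f [Sf f_pos sum_gt0 ->]] _] le_c.
by rewrite ler_pdivlMr // le_c.
Qed.

Lemma attained_sub S1 S2 : attained S1 -> attained S2 ->
  (forall f, S1 f -> S2 f) -> minimum (ratios S2) <= minimum (ratios S1).
Proof.
move=> [/ratiosP[f [S1f f_pos sum_gt0 ->]] _] att2 sub.
by apply: attained_le => //; exact: sub.
Qed.

Import numFieldNormedType.Exports.
Local Open Scope classical_set_scope.

(** [K] governs the values on [A] and [L] those outside. As 0 lies in [A], only [K] has to contain
    1. *)
Lemma cone_attained A S (K L : set R) : 0 \in A ->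
    closed K -> closed L ->
    (forall a r, 0 <= a -> K r -> K (a * r)) ->
    (forall a r, 0 <= a -> L r -> L (a * r)) ->
    K 0 -> K 1 -> L 0 ->
    (forall f, S f <-> nonzero f /\
       ((forall x, x \notin A -> L (f x)) /\ forall x, x \in A -> K (f x))) ->
  attained S.
Proof.
move=> A0 Kc Lc Ks Ls K0 K1 L0 SE.
pose M x := if x \in A then K else L.
have -> : S = cone_class M.
  apply/funext => f; apply/propext; rewrite SE /cone_class /M.
  split=> -[nz]; [move=> [Lf Kf]|move=> Mf]; split=> //.
    by move=> x; case: ifPn => [/Kf|/Lf].
  by split=> x xA; have := Mf x; rewrite ?xA ?(negPf xA).
by apply: minimum_ratios; rewrite /M ?A0 // => x; case: ifP.
Qed.

Lemma classS_attained A : 0 \in A -> attained (classS A).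
Proof.
move=> A0.
apply: (cone_attained A0 closedT (@closed_eq R 0)) => // [a r _ /= ->|f].
  by rewrite mulr0.
by split=> [[? ?]|[? []]].
Qed.

Lemma classSm_attained A : 0 \in A -> attained (classSm A).
Proof.
move=> A0.
apply: (cone_attained A0 closedT (@closed_le R 0)) => //= [a r ? ?|f].
  by rewrite mulr_ge0_le0.
by split=> [[? ?]|[? []]].
Qed.

Lemma classSp_attained A : 0 \in A -> attained (classSp A).
Proof.
move=> A0; apply: (cone_attained A0 (@closed_ge R 0) (@closed_eq R 0)) => //=.
- by move=> a r ? ?; rewrite mulr_ge0.
- by move=> a r _ ->; rewrite mulr0.
- by move=> f; split=> [[? ?]|[? []]].
Qed.

Lemma classSpm_attained A : 0 \in A -> attained (classSpm A).
Proof.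
move=> A0; apply: (cone_attained A0 (@closed_ge R 0) (@closed_le R 0)) => //=.
- by move=> a r ? ?; rewrite mulr_ge0.
- by move=> a r ? ?; rewrite mulr_ge0_le0.
- by move=> f; split=> [[? ?]|[? []]].
Qed.

End Attained.

(** * The chain of inequalities *)

Section Inequalities.
Variables (R : realType) (G : finZmodType).
Implicit Types (f g : G -> R) (A B : {set G}).

Definition indic B (x : G) : R := (x \in B)%:R.

Lemma sum_indic B : \sum_x indic B x = #|B|%:R.
Proof.
rewrite -sum1_card natr_sum [RHS]big_mkcond; apply: eq_bigr => x _.
by rewrite /indic; case: ifP.
Qed.

Lemma autocorr_indic0 B : autocorr (indic B) 0 = #|B|%:R.
Proof.
rewrite -sum_indic; apply: eq_bigr => x _; rewrite addr0 /indic.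
by case: (x \in B); rewrite ?mulr0 ?mulr1.
Qed.

Lemma autocorr_indic_ge0 B d : 0 <= autocorr (indic B) d.
Proof. by rewrite sumr_ge0 // => x _; rewrite mulr_ge0 // ler0n. Qed.

Lemma autocorr_indic_eq0 B d : d \notin diffset B -> autocorr (indic B) d = 0.
Proof.
move=> dB; rewrite /autocorr big1 // => y _; rewrite /indic.
case: (boolP (y + d \in B)) => yd; rewrite ?mul0r //.
case: (boolP (y \in B)) => yB; rewrite ?mulr0 //.
by case/negP: dB; apply/imset2P; exists (y + d) y => //; rewrite addrC addKr.
Qed.

Lemma diffset1 : diffset [set (0 : G)] = [set 0]%SET.
Proof.
apply/setP => x; rewrite inE; apply/imset2P/eqP => [[y z]|->].
  by rewrite !inE => /eqP -> /eqP -> ->; rewrite subr0.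
by exists 0 0; rewrite ?inE // subr0.
Qed.

Lemma Delta_gt0 A : 0 \in A -> (0 < Delta A)%N.
Proof.
move=> A0; rewrite -(cards1 (0 : G)); apply: leq_bigmax_cond.
by rewrite diffset1; apply/eqP/finset.setIidPl; rewrite finset.sub1set.
Qed.

Lemma Deltabar_gt0 A : 0 \in A -> (0 < Deltabar A)%N.
Proof.
move=> A0; rewrite -(cards1 (0 : G)); apply: leq_bigmax_cond.
by rewrite diffset1 finset.sub1set.
Qed.

Lemma card_gt0R : 0 < #|G|%:R :> R.
Proof. by rewrite lt0r card_zmod_neq0 ler0n. Qed.

Lemma inv_card_le_delta A : 0 \in A -> 1 / #|G|%:R <= delta R A.
Proof.
move=> A0; rewrite ler_pM2r ?invr_gt0 ?card_gt0R //.
by rewrite (ler_nat _ 1) Delta_gt0.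
Qed.

Lemma deltabar_le1 A : 0 \in A -> deltabar R A <= 1.
Proof.
move=> A0; rewrite /deltabar div1r invf_le1 ?ltr0n ?Deltabar_gt0 //.
by rewrite (ler_nat _ 1) Deltabar_gt0.
Qed.

Lemma delta_le_lambdam A : 0 \in A -> delta R A <= lambdam R A.
Proof.
move=> A0; apply: attained_ge => [|f [_ f_le0] f_pos sum_gt0].
  exact: classSm_attained.
rewrite /delta mulrAC ler_pdivrMr ?card_gt0R // [leRHS]mulrC.
have qf0_ge0 : 0 <= #|G|%:R * f 0.
  exact: mulr_ge0 (ltW card_gt0R)
    (le_trans (normr_ge0 _) (pos_transform_norm_le 0 f_pos)).
(* The bound is checked for each [B] and passes to the maximum; for the initial value 0 and for
   empty [B] it reduces to [qf0_ge0]. *)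
rewrite /Delta; elim/big_ind: _ => [|m n mP nP|B].
- by rewrite mul0r.
- by rewrite /maxn; case: ifP.
move=> /eqP BA; have [->|B0] := posnP #|B|.
  by rewrite mul0r.
have B_gt0 : 0 < #|B|%:R :> R by rewrite ltr0n.
have := autocorr_ineq (indic B) f_pos; rewrite sum_indic => ineq.
rewrite -(ler_pM2r B_gt0) mulrAC -expr2 [leLHS]mulrC; apply: le_trans ineq _.
rewrite -mulrA ler_pM2l ?card_gt0R // (bigD1 0) //= autocorr_indic0.
(* For [d] other than 0: inside [A] it is not a difference of elements of [B], so the
   autocorrelation vanishes; outside [A] the value [f d] is nonpositive. *)
rewrite gerDl sumr_le0 // => d d0; have [dA|dA] := boolP (d \in A).
  rewrite autocorr_indic_eq0 ?mulr0 //; apply: contra d0 => dB.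
  by rewrite -finset.in_set1 -BA inE dB.
by rewrite mulr_le0_ge0 ?f_le0 ?autocorr_indic_ge0.
Qed.

Lemma lambdap_le_deltabar A : 0 \in A -> lambdap R A <= deltabar R A.
Proof.
move=> A0; rewrite /deltabar.
have [|B BA BE] := @eq_bigmax_cond _ [pred B | diffset B \subset A]
  (fun B => #|B|).
  by apply/card_gt0P; exists [set 0]%SET;
     rewrite inE /= diffset1 finset.sub1set.
have B_gt0 : 0 < #|B|%:R :> R.
  by rewrite ltr0n -BE; exact: Deltabar_gt0.
rewrite /Deltabar BE; have -> : 1 / #|B|%:R =
    autocorr (indic B) 0 / \sum_x autocorr (indic B) x.
  by rewrite sum_autocorr autocorr_indic0 sum_indic; field; rewrite gt_eqF.
apply: attained_le.
- exact: classSp_attained.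
- split=> [|x xA|x _]; last exact: autocorr_indic_ge0.
    by exists 0; rewrite autocorr_indic0 gt_eqF.
  by apply: autocorr_indic_eq0; apply: contra xA; exact: (fintype.subsetP BA).
- exact: autocorr_pos_transform.
- by rewrite sum_autocorr sum_indic exprn_gt0.
Qed.

Lemma lambdam_le_lambda A : 0 \in A -> lambdam R A <= lambda R A.
Proof.
move=> A0; apply: attained_sub => [||f [nz f0]].
- exact: classS_attained.
- exact: classSm_attained.
- by split=> // x /f0 ->.
Qed.

Lemma lambda_le_lambdap A : 0 \in A -> lambda R A <= lambdap R A.
Proof.
move=> A0; apply: attained_sub => [||f [nz f0 _]] //.
- exact: classSp_attained.
- exact: classS_attained.
Qed.

Lemma lambdam_le_lambdapm A : 0 \in A -> lambdam R A <= lambdapm R A.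
Proof.
move=> A0; apply: attained_sub => [||f [nz f0 _]] //.
- exact: classSpm_attained.
- exact: classSm_attained.
Qed.

Lemma lambdapm_le_lambdap A : 0 \in A -> lambdapm R A <= lambdap R A.
Proof.
move=> A0; apply: attained_sub => [||f [nz f0 ?]].
- exact: classSp_attained.
- exact: classSpm_attained.
- by split=> // x /f0 ->.
Qed.

Lemma lambda_chain (A : {set G}) : standard A ->
  (1 / #|G|%:R <= delta R A /\ delta R A <= lambdam R A /\
   lambdam R A <= lambda R A /\ lambda R A <= lambdap R A /\
   lambdap R A <= deltabar R A /\ deltabar R A <= 1) /\
  (lambdam R A <= lambdapm R A /\ lambdapm R A <= lambdap R A).
Proof.
move=> [_ A0]; split; last first.
  by split; [exact: lambdam_le_lambdapm|exact: lambdapm_le_lambdap].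
do 5![split; first by [exact: inv_card_le_delta|exact: delta_le_lambdam|
  exact: lambdam_le_lambda|exact: lambda_le_lambdap|
  exact: lambdap_le_deltabar]].
exact: deltabar_le1.
Qed.

End Inequalities.

(** * Examples *)

Section Pentagon.
Variable R : realType.
Implicit Types (f : 'Z_5 -> R) (B : {set 'Z_5}).

Definition pentagon : {set 'Z_5} := [set 0; 1; -1]%SET.
Definition pentagram : {set 'Z_5} := [set 0; 2; -2]%SET.

Lemma pentagon_standard : standard pentagon.
Proof.
split; last by rewrite !inE.
by apply/setP => x; rewrite !imsetU !imset_set1 !inE opprK oppr0 orbAC.
Qed.

Lemma pentagram_standard : standard pentagram.
Proof.
split; last by rewrite !inE.
by apply/setP => x; rewrite !imsetU !imset_set1 !inE opprK oppr0 orbAC.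
Qed.

Lemma card_Z5 : #|'Z_5| = 5%N.
Proof. exact: card_ord. Qed.

(** [B] and its translate by -1 are disjoint in a group of order 5. *)
Lemma card_nonadjacent B : 1 \notin diffset B -> (#|B| <= 2)%N.
Proof.
move=> B1; suff: (#|B| + #|B| <= 5)%N by lia.
have cardE : #|B| = (\sum_x (x \in B))%N by rewrite -sum1_card big_mkcond.
rewrite {1}cardE cardE [X in (_ + X)%N](reindex_inj (addrI (1 : 'Z_5))) /=.
rewrite -big_split /= -[X in (_ <= X)%N]card_Z5 -sum1_card leq_sum // => x _.
case: (boolP (x \in B)) => // xB; case: (boolP (1 + x \in B)) => // yB.
by case/negP: B1; apply/imset2P; exists (1 + x) x => //; rewrite addrK.
Qed.

Lemma Delta_pentagon : (Delta pentagon <= 2)%N.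
Proof.
apply/bigmax_leqP => B /eqP BA; apply: card_nonadjacent.
apply/negP => B1; have : 1 \in diffset B :&: pentagon by rewrite !inE B1.
by rewrite BA inE.
Qed.

Lemma Deltabar_pentagram : (Deltabar pentagram <= 2)%N.
Proof.
apply/bigmax_leqP => B /fintype.subsetP BA; apply: card_nonadjacent.
by apply/negP => /BA; rewrite !inE.
Qed.

(* The autocorrelation of pent is supported on the pentagram, and the ratio of
   its sum to its value at 0 is 1681 / 769 > 2 (the optimum is sqrt 5, attained
   only by irrational weights). *)
Definition pent (x : 'Z_5) : R := nth 0 [:: -7; 18; 6; 6; 18] x.

Lemma sum_pent : \sum_x pent x = 41.
Proof. by rewrite !big_ord_recl big_ord0 /pent /=; lra. Qed.

Lemma autocorr_pent d : autocorr pent d = nth 0 [:: 769; 0; 456; 456; 0] d.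
Proof.
rewrite /autocorr !big_ord_recl big_ord0 /pent.
by case: d => -[|[|[|[|[|//]]]]] ? /=; lra.
Qed.

Lemma delta_lt_lambdam : delta R pentagon < lambdam R pentagon.
Proof.
have A0 : 0 \in pentagon by rewrite !inE.
(* The constant is 41 ^ 2 / (5 * 769), given by [autocorr_ineq] for [pent]; it exceeds 2 / 5. *)
apply: (@lt_le_trans _ _ (1681 / 3845)).
  rewrite /delta card_Z5; have : (Delta pentagon)%:R <= 2 :> R.
    by rewrite ler_nat Delta_pentagon.
  lra.
apply: attained_ge => [|f [_ f_le0] f_pos _]; first exact: classSm_attained.
have := autocorr_ineq pent f_pos; rewrite sum_pent card_Z5.
rewrite [\sum_d f d * _](bigD1 0) //=.
rewrite autocorr_pent /=; set s := \sum_(d | d != 0) _.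
suff : s <= 0 by lra.
rewrite sumr_le0 // => d d0; rewrite autocorr_pent.
have [dA|/f_le0 fd] := boolP (d \in pentagon).
  suff -> : nth 0 [:: 769; 0; 456; 456; 0] d = 0 :> R by rewrite mulr0.
  by move: d0 dA; rewrite !inE; case: d => -[|[|[|[|[|//]]]]].
rewrite mulr_le0_ge0 //.
by case: d {d0 fd} => -[|[|[|[|[|//]]]]] /=.
Qed.

Lemma lambdap_lt_deltabar : lambdap R pentagram < deltabar R pentagram.
Proof.
have A0 : 0 \in pentagram by rewrite !inE.
(* The ratio of the competitor [autocorr pent], below 1 / 2. *)
apply: (@le_lt_trans _ _ (769 / 1681)); last first.
  rewrite /deltabar; have : (Deltabar pentagram)%:R <= 2 :> R.
    by rewrite ler_nat Deltabar_pentagram.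
  have : 0 < (Deltabar pentagram)%:R :> R by rewrite ltr0n Deltabar_gt0.
  move: (_%:R) => D D0 D2; rewrite ltr_pdivlMr //; lra.
rewrite (_ : 769 / 1681 = autocorr pent 0 / \sum_x autocorr pent x); last first.
  by rewrite sum_autocorr autocorr_pent sum_pent /=; lra.
apply: attained_le.
- exact: classSp_attained.
- split=> [|x|x].
  + by exists 0; rewrite autocorr_pent /= pnatr_eq0.
  + rewrite autocorr_pent !inE.
    by case: x => -[|[|[|[|[|//]]]]].
  + rewrite autocorr_pent => _.
    by case: x => -[|[|[|[|[|//]]]]] /=.
- exact: autocorr_pos_transform.
- by rewrite sum_autocorr sum_pent exprn_gt0 // ltr0n.
Qed.

(** The whole group is admissible for {0}, since every difference set is cut down to {0}. *)
Lemma inv_card_lt_delta : 1 / #|'Z_5|%:R < delta R [set 0%R : 'Z_5].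
Proof.
have : (5 <= Delta [set 0%R : 'Z_5])%N.
  rewrite -[X in (X <= _)%N]card_Z5 -cardsT; apply: leq_bigmax_cond.
  apply/eqP/finset.setIidPr; rewrite finset.sub1set.
  by apply/imset2P; exists 0 0; rewrite ?inE ?subr0.
by rewrite /delta card_Z5 -(ler_nat R); lra.
Qed.

Lemma deltabar_lt1 : deltabar R [set: 'Z_5] < 1.
Proof.
have D5 : (5 <= Deltabar [set: 'Z_5])%N.
  rewrite -[X in (X <= _)%N]card_Z5 -cardsT; apply: leq_bigmax_cond.
  exact: finset.subsetT.
by rewrite /deltabar div1r invf_lt1 ?(ltr_nat _ 1) ?ltr0n (leq_trans _ D5).
Qed.

End Pentagon.

(** * Real characters and sums of functions with nonnegative transform *)

Section RealCharacters.
Variables (R : realType) (G : finZmodType).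
Implicit Types (f g u v : G -> R).

Definition real_character u := is_character (fun x => (u x)%:C).

Lemma real_characterM u v : real_character u -> real_character v ->
  real_character (fun x => u x * v x).
Proof.
move=> chu chv; rewrite /real_character.
rewrite (_ : (fun x => _) = fun x => (u x)%:C * (v x)%:C).
  exact: character_mul.
by apply/funext => x; rewrite rmorphM.
Qed.

(** The transform at [gamma] is the sum of the product character, hence q or 0. *)
Lemma pos_transform_character u : real_character u -> pos_transform u.
Proof.
by move=> chu gamma chg; apply: sum_character_ge0; exact: character_mul.
Qed.

Lemma sum_mul_character_ge0 f u : real_character u -> pos_transform f ->
  0 <= \sum_x f x * u x.
Proof.
move=> chu /(_ _ chu); rewrite -ler0c rmorph_sum.
by under [X in _ -> _ <= X]eq_bigr => x _ do rewrite rmorphM mulrC.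
Qed.

Lemma pos_transformD f g : pos_transform f -> pos_transform g ->
  pos_transform (fun x => f x + g x).
Proof.
move=> f_pos g_pos gamma chg.
rewrite (_ : fourier _ _ = fourier f gamma + fourier g gamma).
  by rewrite addr_ge0 ?f_pos ?g_pos.
by rewrite -big_split; apply: eq_bigr => x _; rewrite rmorphD mulrDr.
Qed.

Lemma pos_transform_sum (I : Type) (s : seq I) (F : I -> G -> R) :
  (forall k, pos_transform (F k)) ->
  pos_transform (fun x => \sum_(k <- s) F k x).
Proof.
move=> F_pos; elim: s => [|k s IH].
  move=> gamma _; rewrite /fourier big1 // => x _.
  by rewrite big_nil mulr0.
rewrite (_ : (fun x => _) = fun x => F k x + \sum_(k <- s) F k x).
  exact: pos_transformD.
by apply/funext => x; rewrite big_cons.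
Qed.

End RealCharacters.

(** * Incomparability of [lambda] and [lambdapm], in the group (Z/2)^5 *)

Section Cube.
Variable R : realType.
Local Notation cube := 'rV['Z_2]_5.
Implicit Types (x : cube) (F : cube -> R).

(** The index is a natural number, read through [inord], so that [iota] and [triples] can list the
    characters. *)
Definition coord_sign k x : R := (-1) ^+ (x ord0 (inord k)).

Local Notation s := coord_sign.

Lemma coord_sign_cases k x : s k x = 1 \/ s k x = -1.
Proof. by rewrite /s -signr_odd; case: odd; [right|left]. Qed.

Lemma coord_sign_eq1 k x : s k x = 1 -> x ord0 (inord k) = 0.
Proof.
rewrite /s; case: (x ord0 _) => -[|[|//]] lt /= => [_|]; first exact: val_inj.
by rewrite expr1 => ?; exfalso; lra.
Qed.

Lemma coord_sign_character k : real_character (s k).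
Proof.
split=> [x|x y].
  by case: (coord_sign_cases k x) => ->; rewrite ?rmorphN1 ?normrN normr1.
rewrite -rmorphM /s mxE; congr (_%:C); rewrite -exprD.
by rewrite -[LHS]signr_odd -[RHS]signr_odd /= odd_mod.
Qed.

Definition triples : seq (nat * nat * nat) :=
  [:: (0, 1, 2); (0, 1, 3); (0, 1, 4); (0, 2, 3); (0, 2, 4); (0, 3, 4);
      (1, 2, 3); (1, 2, 4); (1, 3, 4); (2, 3, 4)]%N.

(* As functions of the Hamming weight w = 0, ..., 5 these are
   cube_f = 8, 4, 4, 0, 0, -4 and cube_h = 12, 0, 0, 4, 4, -8. *)
Definition cube_f x : R :=
  2 + \sum_(k <- iota 0 5) s k x + s 0 x * s 1 x * s 2 x * s 3 x * s 4 x.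

Definition cube_h x : R :=
  2 + \sum_(t <- triples) s t.1.1 x * s t.1.2 x * s t.2 x.

Lemma cube_f0 : cube_f 0 = 8.
Proof. by rewrite /cube_f !big_cons big_nil /s !mxE /=; lra. Qed.

Lemma cube_h0 : cube_h 0 = 12.
Proof. by rewrite /cube_h !big_cons big_nil /s !mxE /=; lra. Qed.

Lemma cube_signs x : x != 0 ->
  [\/ 0 < cube_f x /\ cube_h x = 0, cube_f x = 0 /\ 0 <= cube_h x
    | cube_f x < 0 /\ cube_h x <= 0].
Proof.
move=> /eqP x0; rewrite /cube_f /cube_h !big_cons !big_nil /=.
have [e0|e0] := coord_sign_cases 0 x; have [e1|e1] := coord_sign_cases 1 x;
have [e2|e2] := coord_sign_cases 2 x; have [e3|e3] := coord_sign_cases 3 x;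
have [e4|e4] := coord_sign_cases 4 x.
  (* The pattern with all signs 1 is the excluded [x = 0]; the other 31 are evaluated one by one. *)
  case: x0; apply/rowP => j; rewrite [RHS]mxE -[j]inord_val.
  by case: j => -[|[|[|[|[|//]]]]] lt /=; exact: coord_sign_eq1.
all: rewrite e0 e1 e2 e3 e4;
  first [apply: Or31; lra | apply: Or32; lra | apply: Or33; lra].
Qed.

Lemma cube_f_pos_transform : pos_transform cube_f.
Proof.
have sch := coord_sign_character.
apply: pos_transformD; first apply: pos_transformD.
- rewrite (_ : (fun=> _) = fun x : cube => 2 * (1 : R)); last first.
    by apply/funext => x; rewrite mulr1.
  apply: (@pos_transformZ _ _ (fun=> 1)) => //; apply: pos_transform_character.
  exact: principal_character.
- apply: pos_transform_sum => k; exact: pos_transform_character.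
- by apply: pos_transform_character; do !apply: real_characterM.
Qed.

(** The constant 2 contributes 2 * 32, and every character has nonnegative sum. *)
Lemma sum_cube_f : 64 <= \sum_x cube_f x.
Proof.
have sum_ge0 u : real_character u -> 0 <= \sum_x u x :> R.
  by move=> /pos_transform_character /pos_transform_sum_ge0.
have sch := coord_sign_character.
rewrite !big_split /= sumr_const card_mx card_ord exchange_big /=.
set a := \sum_(k <- _) _; set b := \sum_x _.
have a0 : 0 <= a by apply: sumr_ge0 => k _; exact: sum_ge0.
have b0 : 0 <= b by apply: sum_ge0; do !apply: real_characterM.
by rewrite (_ : (_ ^ _)%N = 32%N) //; lra.
Qed.

Lemma cube_f_nonzero : nonzero cube_f.
Proof. by exists 0; rewrite cube_f0 pnatr_eq0. Qed.

Lemma cube_f_ratio : 0 < \sum_x cube_f x /\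
  cube_f 0 / \sum_x cube_f x <= 1 / 8.
Proof.
have := sum_cube_f; move: (\sum_x _) => S S64.
have S_gt0 : 0 < S by lra.
by split=> //; rewrite cube_f0 ler_pdivrMr //; lra.
Qed.

Lemma cube_h_ineq F : pos_transform F ->
    (forall x, x != 0 -> F x * cube_h x <= 0) ->
  1 / 6 * \sum_x F x <= F 0.
Proof.
move=> F_pos Fh; have sch := coord_sign_character.
have : \sum_x F x * cube_h x <= 12 * F 0.
  by rewrite (bigD1 0) //= cube_h0 mulrC gerDl sumr_le0.
(* Pairing [F] with the constant 2 of [cube_h] gives the left side; pairing it with each character
   of weight 3 gives a nonnegative transform value. *)
have : 2 * \sum_x F x <= \sum_x F x * cube_h x.
  rewrite [leRHS](eq_bigr (fun x => 2 * F x +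
    \sum_(t <- triples) F x * (s t.1.1 x * s t.1.2 x * s t.2 x))); last first.
    by move=> x _; rewrite /cube_h mulrDr big_distrr [F x * 2]mulrC.
  rewrite big_split -big_distrr exchange_big lerDl sumr_ge0 //= => t _.
  by apply: sum_mul_character_ge0 => //; do !apply: real_characterM.
lra.
Qed.

(** Every element of the group is its own inverse. *)
Lemma standard_cube (A : {set cube}) : 0 \in A -> standard A.
Proof.
move=> A0; split=> //; have oppE x : - x = x.
  apply/rowP => j; rewrite mxE; case: (x ord0 j) => -[|[|//]] lt;
  exact: val_inj.
by rewrite (eq_imset _ oppE) imset_id.
Qed.

Definition cube_pos : {set cube} := [set x | 0 < cube_f x]%SET.
Definition cube_supp : {set cube} := [set x | cube_f x != 0]%SET.

Lemma cube_pos0 : 0 \in cube_pos. Proof. by rewrite inE cube_f0 ltr0n. Qed.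
Lemma cube_supp0 : 0 \in cube_supp.
Proof. by rewrite inE cube_f0 pnatr_eq0. Qed.

Lemma lambdapm_lt_lambda : lambdapm R cube_pos < lambda R cube_pos.
Proof.
have [S_gt0 ratio] := cube_f_ratio.
apply: (@le_lt_trans _ _ (1 / 8)).
  apply: le_trans ratio; apply: attained_le => //.
  - exact/classSpm_attained/cube_pos0.
  - split=> [|x|x]; rewrite ?inE; first exact: cube_f_nonzero.
      by rewrite -leNgt.
    exact: ltW.
  - exact: cube_f_pos_transform.
apply: (@lt_le_trans _ _ (1 / 6)); first by lra.
apply: attained_ge => [|F [_ F0] F_pos _].
  exact/classS_attained/cube_pos0.
(* Away from 0, [cube_h] vanishes on [cube_pos] and [F] vanishes off it. *)
apply: cube_h_ineq => // x /cube_signs[[_ ->]|[fx _]|[fx _]].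
- by rewrite mulr0.
- by rewrite F0 ?mul0r // inE fx ltxx.
- by rewrite F0 ?mul0r // inE -leNgt ltW.
Qed.

Lemma lambda_lt_lambdapm : lambda R cube_supp < lambdapm R cube_supp.
Proof.
have [S_gt0 ratio] := cube_f_ratio.
apply: (@le_lt_trans _ _ (1 / 8)).
  apply: le_trans ratio; apply: attained_le => //.
  - exact/classS_attained/cube_supp0.
  - split=> [|x]; rewrite ?inE; first exact: cube_f_nonzero.
    by move=> /negbNE/eqP.
  - exact: cube_f_pos_transform.
apply: (@lt_le_trans _ _ (1 / 6)); first by lra.
apply: attained_ge => [|F [_ F_le0 F_ge0] F_pos _].
  exact/classSpm_attained/cube_supp0.
(* Where [cube_f] is zero, [F] is nonpositive and [cube_h] nonnegative; where [cube_f] is negative,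
   the two signs are reversed. *)
apply: cube_h_ineq => // x /cube_signs[[_ ->]|[fx hx]|[fx hx]].
- by rewrite mulr0.
- by rewrite mulr_le0_ge0 // F_le0 // inE fx eqxx.
- by rewrite mulr_ge0_le0 // F_ge0 // inE lt_eqF.
Qed.

End Cube.

(** * Assembly of the inequalities and the examples *)

Lemma standard1 (G : finZmodType) : standard [set 0%R : G].
Proof. by split; rewrite ?inE // imset_set1 oppr0. Qed.

Lemma standardT (G : finZmodType) : standard [set: G].
Proof.
split; rewrite ?inE //; apply/setP => x; rewrite inE; apply/esym/imsetP.
by exists (- x); rewrite ?inE ?opprK.
Qed.

Theorem theorem1p4 (R : realType) :
  (forall (G : finZmodType) (A : {set G}), standard A ->
    (1 / #|G|%:R <= delta R A /\ delta R A <= lambdam R A /\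
     lambdam R A <= lambda R A /\ lambda R A <= lambdap R A /\
     lambdap R A <= deltabar R A /\ deltabar R A <= 1) /\
    (lambdam R A <= lambdapm R A /\ lambdapm R A <= lambdap R A)) /\
  (sometimes_eq_sometimes_lt (fun (G : finZmodType) _ => 1 / #|G|%:R)
     (@delta R) /\
   sometimes_eq_sometimes_lt (@delta R) (@lambdam R) /\
   sometimes_eq_sometimes_lt (@lambdam R) (@lambda R) /\
   sometimes_eq_sometimes_lt (@lambda R) (@lambdap R) /\
   sometimes_eq_sometimes_lt (@lambdap R) (@deltabar R) /\
   sometimes_eq_sometimes_lt (@deltabar R) (fun _ _ => 1) /\
   sometimes_eq_sometimes_lt (@lambdam R) (@lambdapm R) /\
   sometimes_eq_sometimes_lt (@lambdapm R) (@lambdap R)) /\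
  (for_some_standard (fun G A => lambda R A > lambdapm R A) /\
   for_some_standard (fun G A => lambda R A < lambdapm R A) /\
   for_some_standard (fun G A => lambda R A = lambdapm R A)).
Proof.
have chain := @lambda_chain R.
split=> //.
(* On the trivial group the chain starts and ends at 1, so all its terms agree. *)
have [[c1 [c2 [c3 [c4 [c5 c6]]]]] [c7 c8]] := chain _ _ (standardT 'I_1).
rewrite card_ord divr1 in c1.
have pm_lt := @lambdapm_lt_lambda R; have lt_pm := @lambda_lt_lambdapm R.
have std_pos := standard_cube (@cube_pos0 R).
have std_supp := standard_cube (@cube_supp0 R).
(* On [cube_pos] the strict step lies in [lambdam <= lambdapm < lambda <= lambdap], and on
   [cube_supp] in [lambdam <= lambda < lambdapm <= lambdap]. These two chains give the four
   remaining strict inequalities. *)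
have [[_ [_ [p3 [p4 _]]]] [p7 p8]] := chain _ _ std_pos.
have [[_ [_ [q3 [q4 _]]]] [q7 q8]] := chain _ _ std_supp.
have trivial_eq (u v : forall G : finZmodType, {set G} -> R) :
    u 'I_1 [set: 'I_1] = v 'I_1 [set: 'I_1] ->
    for_some_standard (fun G A => u G A = v G A).
  by move=> uv; exists 'I_1, [set: 'I_1]; split=> //; exact: standardT.
split; last first.
  split; first by exists 'rV['Z_2]_5, (cube_pos R).
  split; first by exists 'rV['Z_2]_5, (cube_supp R).
  by apply: trivial_eq; lra.
split.
  split; first by apply: trivial_eq; rewrite card_ord divr1; lra.
  exists 'Z_5, [set 0%R : 'Z_5].
  by split; [exact: standard1|exact: inv_card_lt_delta].
split.
  split; first by apply: trivial_eq; lra.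
  exists 'Z_5, pentagon.
  by split; [exact: pentagon_standard|exact: delta_lt_lambdam].
split.
  split; first by apply: trivial_eq; lra.
  by exists 'rV['Z_2]_5, (cube_pos R); split=> //; lra.
split.
  split; first by apply: trivial_eq; lra.
  by exists 'rV['Z_2]_5, (cube_supp R); split=> //; lra.
split.
  split; first by apply: trivial_eq; lra.
  exists 'Z_5, pentagram.
  by split; [exact: pentagram_standard|exact: lambdap_lt_deltabar].
split.
  split; first by apply: trivial_eq; lra.
  by exists 'Z_5, [set: 'Z_5]; split; [exact: standardT|exact: deltabar_lt1].
split; (split; first by apply: trivial_eq; lra).
  by exists 'rV['Z_2]_5, (cube_supp R); split=> //; lra.
by exists 'rV['Z_2]_5, (cube_pos R); split=> //; lra.
Qed.
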